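(* Let $\mathcal T_1=(S_1,\Sigma_1,\kappa_1,\mathrm{AP},\mathcal L_1)$ and $\mathcal T_2=(S_2,\Sigma_2,\kappa_2,\mathrm{AP},\mathcal L_2)$ be labelled stochastic transition systems such that $\mathcal T_2$ is a denumerable Markov chain with a finite attractor and $\mathcal T_2$ is an $\alpha$-abstraction of $\mathcal T_1$ (as labelled systems), for a measurable $\alpha:S_1\to S_2$. Let $\mathcal M=(Q,q_0,E,\mathcal F)$ be a deterministic Muller automaton over $\mathrm{AP}$. Assume moreover that $\mathcal T_2\ltimes\mathcal M$ is a sound $\alpha_{\mathcal M}$-abstraction of $\mathcal T_1\ltimes\mathcal M$, where $\alpha_{\mathcal M}(s,q)=(\alpha(s),q)$. Then for every initial distribution $\mu\in\mathrm{Dist}(S_1)$ for $\mathcal T_1$: $$\mathrm{Prob}^{\mathcal T_1\ltimes\mathcal M}_{\mu\times\delta_{q_0}}(\mathrm{Inf}\in\mathcal F)=1\iff\mathrm{Prob}^{\mathcal T_2\ltimes\mathcal M}_{(\alpha_{\mathcal M})_\#(\mu\times\delta_{q_0})}(\mathrm{Inf}\in\mathcal F)=1.$$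
   Context: A labelled stochastic transition system (LSTS) is $\mathcal T=(S,\Sigma,\kappa,\mathrm{AP},\mathcal L)$ with $(S,\Sigma)$ a measurable space, $\kappa:S\times\Sigma\to[0,1]$ a Markov kernel, $\mathrm{AP}$ a finite set and $\mathcal L:S\to2^{\mathrm{AP}}$ measurable. It is a denumerable Markov chain if $S$ is at most countable and $\Sigma=2^S$. $\mathrm{Dist}(S)$ is the set of probability measures on $(S,\Sigma)$; $\mathrm{Prob}^{\mathcal T}_\mu$ is the law on $S^\omega$ (cylinder $\sigma$-algebra) of the Markov chain with initial distribution $\mu$ and kernel $\kappa$. $\mathbf F B$ is the event that $B$ is visited at some time $i\ge0$. $B\in\Sigma$ is an attractor for $\mathcal T$ if $\mathrm{Prob}^{\mathcal T}_\mu(\mathbf F B)=1$ for every $\mu\in\mathrm{Dist}(S)$. $\Omega_{\mathcal T}(\mu)(A)=\int_S\kappa(s,A)\,\mu(\mathrm ds)$; $\alpha_\#(\mu)(M)=\mu(\alpha^{-1}(M))$. $\mathcal T_2$ is an $\alpha$-abstraction of $\mathcal T_1$ if for every $\mu\in\mathrm{Dist}(S_1)$ the measures $\alpha_\#(\Omega_{\mathcal T_1}(\mu))$ and $\Omega_{\mathcal T_2}(\alpha_\#(\mu))$ have the same null sets; for labelled systems over the same $\mathrm{AP}$ one also requires $\alpha(s)=\alpha(s')\Rightarrow\mathcal L_1(s)=\mathcal L_1(s')$ and $\mathcal L_2(\alpha(s))=\mathcal L_1(s)$ for all $s,s'\in S_1$. An $\alpha$-abstraction is sound if for every $\mu\in\mathrm{Dist}(S_1)$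 and $B\in\Sigma_2$: $\mathrm{Prob}^{\mathcal T_2}_{\alpha_\#(\mu)}(\mathbf F B)=1$ implies $\mathrm{Prob}^{\mathcal T_1}_\mu(\mathbf F\alpha^{-1}(B))=1$. (Same definitions for $\mathcal T_i\ltimes\mathcal M$ and $\alpha_{\mathcal M}:S_1\times Q\to S_2\times Q$.) A deterministic Muller automaton over $\mathrm{AP}$ is $\mathcal M=(Q,q_0,E,\mathcal F)$ with $Q$ finite, $q_0\in Q$, $E\subseteq Q\times2^{\mathrm{AP}}\times Q$ such that for every $(q,u)$ there is exactly one $q'$ with $(q,u,q')\in E$, and $\mathcal F\subseteq2^Q$. The product $\mathcal T\ltimes\mathcal M$ is the LSTS with state space $S\times Q$, $\sigma$-algebra $\Sigma\otimes2^Q$, kernel $\kappa'((s,q),A\times\{q'\})=\kappa(s,A)$ if $(q,\mathcal L(s),q')\in E$ and $0$ otherwise, and labelling $(s,q)\mapsto q$. $\mathrm{Inf}\in\mathcal F$ is the event that the set of $q\in Q$ occurring infinitely often as second component along the path belongs to $\mathcal F$. *)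

(* Defs.v *)
From HB Require Import structures.
From mathcomp Require Import all_boot all_order all_algebra.
From mathcomp Require Import all_classical all_reals all_analysis.
From mathcomp Require Import measurable_realfun.

Set Implicit Arguments.
Unset Strict Implicit.
Unset Printing Implicit Defensive.

Import Order.TTheory GRing.Theory Num.Theory.

Local Open Scope classical_set_scope.
Local Open Scope ring_scope.
Local Open Scope ereal_scope.

Record lsts (R : realType) (d : measure_display) (S : measurableType d)
    (AP : finType) := Lsts {
  lsts_kernel :> R.-pker S ~> S ;
  label : S -> {set AP} ;
  label_measurable : forall U : set {set AP}, measurable (label @^-1` U) }.

Definition denumerable (R : realType) (d : measure_display)
    (S : measurableType d) (AP : finType) (T : lsts R S AP) :=
  countable [set: S] /\ forall A : set S, measurable A.

Section path_law.
Context (R : realType) (d : measure_display) (S : measurableType d).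

Definition cylinder (n : nat) (A : nat -> set S) : set (nat -> S) :=
  [set w | forall i, (i <= n)%N -> A i (w i)].

Definition cylinders : set (set (nat -> S)) :=
  [set C | exists n A, (forall i, measurable (A i)) /\ C = cylinder n A].

(* S^omega with the cylinder sigma-algebra. *)
Definition path_space := g_sigma_algebraType cylinders.

(* The probability that the chain with kernel k started in s satisfies
   X_0 \in A 0, ..., X_n \in A n. *)
Fixpoint cylinder_prob (k : R.-pker S ~> S) (n : nat) (A : nat -> set S)
    (s : S) : \bar R :=
  match n with
  | 0%N => (\1_(A 0%N) s)%:E
  | m.+1 => (\1_(A 0%N) s)%:E *
      \int[k s]_t cylinder_prob k m (fun i => A i.+1) t
  end.

(* P is the law Prob^T_mu of the Markov chain with initial distribution mu and
   kernel k.  Cylinders form a pi-system generating the sigma-algebra, so at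
   most one P satisfies this; one exists by the Ionescu-Tulcea theorem. *)
Definition is_path_law (k : R.-pker S ~> S) (mu : probability S R)
    (P : probability path_space R) :=
  forall n (A : nat -> set S), (forall i, measurable (A i)) ->
    P (cylinder n A) = \int[mu]_s cylinder_prob k n A s.

Definition eventually_in (B : set S) : set path_space :=
  [set w | exists i, B (w i)].

Definition attractor (AP : finType) (T : lsts R S AP) (B : set S) :=
  measurable B /\
  forall (mu : probability S R) (P : probability path_space R),
    is_path_law T mu P -> P (eventually_in B) = 1.

Definition Omega (k : R.-pker S ~> S) (mu : probability S R) (A : set S)
  : \bar R := \int[mu]_s k s A.

End path_law.

Section abstraction.
Context (R : realType) (d1 d2 : measure_display).
Context (S1 : measurableType d1) (S2 : measurableType d2) (AP : finType).
Context (T1 : lsts R S1 AP) (T2 : lsts R S2 AP) (alpha : {mfun S1 >-> S2}).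

(* [distribution mu alpha] is the pushforward of mu by alpha, bundled as a
   probability measure. *)
Definition stochastic_abstraction :=
  forall (mu : probability S1 R) (B : set S2), measurable B ->
    pushforward (Omega T1 mu) alpha B = 0 <->
    Omega T2 (distribution mu alpha) B = 0.

Definition abstraction :=
  [/\ stochastic_abstraction,
      (forall s s' : S1, alpha s = alpha s' -> label T1 s = label T1 s') &
      (forall s : S1, label T2 (alpha s) = label T1 s)].

Definition sound_abstraction :=
  abstraction /\
  forall (mu : probability S1 R) (B : set S2), measurable B ->
  forall (P1 : probability (path_space S1) R)
         (P2 : probability (path_space S2) R),
    is_path_law T1 mu P1 -> is_path_law T2 (distribution mu alpha) P2 ->
    P2 (eventually_in B) = 1 -> P1 (eventually_in (alpha @^-1` B)) = 1.

End abstraction.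

Record muller (AP : finType) := Muller {
  mstates : finType ;
  minit : mstates ;
  mtrans : {set mstates * {set AP} * mstates} ;
  mtrans_det : forall q u, exists! q', (q, u, q') \in mtrans ;
  maccept : {set {set mstates}} }.

(* The state set of M as a measurable space with sigma-algebra 2^Q.
   Measurable types are pointed; the point is the initial state. *)
Definition mspace (AP : finType) (M : muller AP) : Type := mstates M.

Section mspace.
Context (AP : finType) (M : muller AP).

HB.instance Definition _ := Finite.on (mspace M).
HB.instance Definition _ := isPointed.Build (mspace M) (minit M).
HB.instance Definition _ := @isMeasurable.Build default_measure_display
  (mspace M) discrete_measurable discrete_measurable0
  discrete_measurableC discrete_measurableU.

End mspace.

Section product.
Context (R : realType) (d : measure_display) (S : measurableType d).
Context (AP : finType) (T : lsts R S AP) (M : muller AP).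

(* kappa'((s, q), U) as the sum over q' of kappa'((s, q), A_q' x {q'}), where
   A_q' is the section of U at q'. *)
Definition product_kernel (x : S * mspace M) (U : set (S * mspace M)) : \bar R :=
  \sum_(q' : mspace M | (x.2, label T x.1, q') \in mtrans M)
    T x.1 (ysection U q').

Lemma product_kernel_rect (s : S) (q q' : mspace M) (A : set S) :
  product_kernel (s, q) (A `*` [set q']) =
  if (q, label T s, q') \in mtrans M then T s A else 0.
Proof.
rewrite /product_kernel big_mkcond /= (bigD1 q') //= big1 ?adde0.
  by rewrite in_ysectionX // inE.
move=> p pq; case: ifP => // _.
rewrite (_ : ysection _ _ = set0) ?measure0 //.
by apply: notin_ysectionX; rewrite notin_setE /=; exact/eqP.
Qed.

Lemma product_kernel_next (x : S * mspace M) : exists q' : mspace M,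
  product_kernel x = pushforward (T x.1) (fun t => (t, q')).
Proof.
have [q' [q'E q'U]] := mtrans_det x.2 (label T x.1).
exists q'; apply/funext => U; rewrite /product_kernel (@big_pred1 _ _ _ (mspace M) q').
  by congr (T x.1 _); apply/seteqP; split=> t /=; rewrite /ysection /= inE.
move=> p; apply/idP/eqP => [pE|-> //].
by rewrite (q'U p pE).
Qed.

Let product_kernel0 x : product_kernel x set0 = 0.
Proof.
by have [q' ->] := product_kernel_next x; rewrite /pushforward preimage_set0 measure0.
Qed.

Let product_kernel_ge0 x U : 0 <= product_kernel x U.
Proof. by have [q' ->] := product_kernel_next x; exact: measure_ge0. Qed.

Let product_kernel_sigma_additive x : semi_sigma_additive (product_kernel x).
Proof.
have [q' ->] := product_kernel_next x.
have mf : measurable_fun setT (fun t : S => (t, q')) by exact: measurable_fun_pair.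
exact: (@measure_semi_sigma_additive _ _ _
  (measure_function_pushforward__canonical__measure_function_Measure (T x.1) mf)).
Qed.

HB.instance Definition _ x := isMeasure.Build _ _ R (product_kernel x)
  (product_kernel0 x) (product_kernel_ge0 x) (@product_kernel_sigma_additive x).

Definition product_kernel_measure :=
  product_kernel : S * mspace M -> {measure set (S * mspace M) -> \bar R}.

Let measurable_product_kernel (U : set (S * mspace M)) : measurable U ->
  measurable_fun setT (product_kernel_measure ^~ U).
Proof.
move=> mU; rewrite /product_kernel_measure /= /product_kernel.
under eq_fun do rewrite big_mkcond /=.
apply: emeasurable_sum => q'.
apply: measurable_fun_ifT => //.
- apply: (measurable_fun_bool true); rewrite setTI.
  rewrite (_ : _ @^-1` _ = \bigcup_(q : mspace M)
    ((label T @^-1` [set u | (q, u, q') \in mtrans M]) `*` [set q])).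
    apply: fin_bigcup_measurable => [|q _]; first exact: finite_finset.
    apply: measurableX => //; exact: (label_measurable T).
  apply/seteqP; split=> [[s q] /= sq|[s q] /= [p _ [/= h ->]]] //.
  by exists q.
- apply: (measurableT_comp (measurable_kernel T _ (measurable_ysection _ mU))).
  exact: measurable_fst.
Qed.

HB.instance Definition _ :=
  isKernel.Build _ _ _ _ R product_kernel_measure measurable_product_kernel.

Let product_kernel_setT x : product_kernel_measure x setT = 1.
Proof.
have [q' e] := product_kernel_next x.
by rewrite /product_kernel_measure /= e /pushforward preimage_setT prob_kernel.
Qed.

HB.instance Definition _ := Kernel_isProbability.Build _ _ _ _ R
  product_kernel_measure product_kernel_setT.

Definition product_label (x : S * mspace M) : {set mstates M} :=
  [set (x.2 : mstates M)]%SET.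

Lemma product_label_measurable (U : set {set mstates M}) :
  measurable (product_label @^-1` U).
Proof.
rewrite (_ : _ @^-1` _ = setT `*` [set q : mspace M | U [set (q : mstates M)]%SET]).
  exact: measurableX.
by apply/seteqP; split=> x //= -[].
Qed.

Definition product : lsts R (S * mspace M)%type (mstates M) :=
  Lsts product_kernel_measure product_label_measurable.

Definition inf_states (w : path_space (S * mspace M)%type) : {set mstates M} :=
  [set q : mstates M | `[< forall n, exists2 m, (n <= m)%N & (w m).2 = q >]]%SET.

Definition inf_accept : set (path_space (S * mspace M)%type) :=
  [set w | inf_states w \in maccept M].

End product.

Arguments inf_accept {d S AP} M.

Section product_map.
Context (d1 d2 : measure_display).
Context (S1 : measurableType d1) (S2 : measurableType d2) (AP : finType).
Context (alpha : {mfun S1 >-> S2}) (M : muller AP).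

Definition product_map (x : S1 * mspace M) : S2 * mspace M :=
  (alpha x.1, x.2).

Lemma measurable_product_map : measurable_fun setT product_map.
Proof.
by apply: measurable_fun_pair => //; exact: measurableT_comp.
Qed.

HB.instance Definition _ :=
  isMeasurableFun.Build _ _ _ _ product_map measurable_product_map.

End product_map.

Arguments product_map {d1 d2 S1 S2 AP} alpha M x.

(* Main.v *)
(** Let [Re] be the set of states of the product of [T2] and [M] that are charged
    at some time by the given law. The product has a finite attractor, so every
    state of [Re] reaches a recurrent attractor state [a], i.e. one whose set
    [reach a] is a bottom component. A maximum principle shows that a set which can be
    reached from every state of [Re] is almost surely hit from every initial
    distribution carried by [Re], and soundness transfers this to [T1]. Hence, in
    both products, almost every path enters some [reach a], stays there (the
    abstraction preserves null transitions), and visits all of its states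
    infinitely often: for the set [B] of states that are either outside [reach a]
    or equal to a given state of it, the hitting statement holds from every time
    on. So both probabilities are 1 exactly when the colours of [reach a] form an
    accepting set for every recurrent [a], as both laws charge the same states at
    each time. *)

Require Import Defs.
From HB Require Import structures.
From mathcomp Require Import all_boot all_order all_algebra finmap.
From mathcomp Require Import all_classical all_reals all_analysis.
From mathcomp Require Import measurable_realfun giry.

Set Implicit Arguments.
Unset Strict Implicit.
Unset Printing Implicit Defensive.

Import Order.TTheory GRing.Theory Num.Theory.

Local Open Scope classical_set_scope.
Local Open Scope ring_scope.
Local Open Scope ereal_scope.

(** * Measurability on the path space *)

Section paths.
Context (d : measure_display) (S : measurableType d).

Definition path_eval (n : nat) (w : path_space S) : S := w n.

Definition path_shift (n : nat) (w : path_space S) : path_space S :=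
  fun i => w (n + i)%N.

Lemma measurable_cylinder n (A : nat -> set S) : (forall i, measurable (A i)) ->
  measurable (cylinder n A : set (path_space S)).
Proof. by move=> mA; apply: sub_sigma_algebra; exists n, A. Qed.

Lemma measurable_path_eval n : measurable_fun setT (path_eval n).
Proof.
move=> _ B mB; rewrite setTI.
rewrite (_ : _ @^-1` _ = cylinder n (fun i => if i == n then B else setT)).
  by apply: measurable_cylinder => i; case: ifP.
apply/seteqP; split=> w /=.
- by move=> Bw i _; case: eqP => // ->.
- by move=> /(_ n (leqnn n)); rewrite eqxx.
Qed.

HB.instance Definition _ n :=
  isMeasurableFun.Build _ _ _ _ (path_eval n) (measurable_path_eval n).

Lemma measurable_eval_preimage n (B : set S) : measurable B ->
  measurable [set w : path_space S | B (w n)].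
Proof. by move=> mB; rewrite -[X in measurable X]setTI; exact: measurable_path_eval. Qed.

Lemma measurable_eventually_in (B : set S) : measurable B ->
  measurable (eventually_in B).
Proof.
move=> mB; rewrite (_ : eventually_in B = \bigcup_n [set w : path_space S | B (w n)]).
  by apply: bigcupT_measurable => n; exact: measurable_eval_preimage.
by apply/seteqP; split=> w [n]; [move=> ?; exists n|move=> _ ?; exists n].
Qed.

(** Cylinders generate the sigma-algebra, and the preimage of a cylinder is an intersection of
    preimages under the coordinates of [f]. *)
Lemma measurable_to_path (d' : measure_display) (T : measurableType d')
    (f : T -> path_space S) :
  (forall n, measurable_fun setT (fun x => f x n)) -> measurable_fun setT f.
Proof.
move=> mf; apply: (@measurability _ _ _ (path_space S) setT f (@cylinders _ S)) => //.
move=> _ [_ [n [A [mA ->]]] <-].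
rewrite setTI (_ : _ @^-1` _ =
    \bigcap_(i in [set i | (i <= n)%N]) [set x | A i (f x i)]).
  apply: bigcap_measurable => [|i _]; first by exists 0%N.
  by rewrite -[X in measurable X]setTI; exact: mf.
by [].
Qed.

Lemma measurable_path_shift n : measurable_fun setT (path_shift n).
Proof.
by apply: measurable_to_path => i; exact: (measurable_path_eval (n + i)).
Qed.

HB.instance Definition _ n :=
  isMeasurableFun.Build _ _ _ _ (path_shift n) (measurable_path_shift n).

End paths.

Section pathwise.
Context (d d' : measure_display) (S : measurableType d) (S' : measurableType d').
Variable f : {mfun S >-> S'}.

Definition pathwise (w : path_space S) : path_space S' := fun i => f (w i).

Lemma measurable_pathwise : measurable_fun setT pathwise.
Proof.
apply: measurable_to_path => i.
by apply: measurableT_comp => //; exact: (measurable_path_eval i).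
Qed.

HB.instance Definition _ :=
  isMeasurableFun.Build _ _ _ _ pathwise measurable_pathwise.

End pathwise.

(** * Cylinder probabilities as measurable functions of the initial state *)

Section cylinder_prob.
Context (R : realType) (d : measure_display) (S : measurableType d).
Variable k : R.-pker S ~> S.

Lemma cylinder_prob_ge0 n (A : nat -> set S) s : 0 <= cylinder_prob k n A s.
Proof.
by elim: n A s => [|n IH] A s /=; rewrite ?mule_ge0 ?lee_fin// integral_ge0.
Qed.

Lemma measurable_integral_pker (f : S -> \bar R) :
  measurable_fun setT f -> (forall s, 0 <= f s) ->
  measurable_fun setT (fun s => \int[k s]_t f t).
Proof.
move=> mf f0.
exact: (@measurable_fun_integral_kernel _ _ _ _ _ k (measurable_kernel k)).
Qed.

Lemma measurable_cylinder_prob n (A : nat -> set S) :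
  (forall i, measurable (A i)) -> measurable_fun setT (cylinder_prob k n A).
Proof.
elim: n A => [|n IH] A mA /=.
  by apply/measurable_EFinP; exact: measurable_indic.
apply: emeasurable_funM.
  by apply/measurable_EFinP; exact: measurable_indic.
apply: measurable_integral_pker; first by apply: IH => i; exact: mA.
by move=> s; exact: cylinder_prob_ge0.
Qed.

Lemma cylinder_prob_le1 n (A : nat -> set S) s :
  (forall i, measurable (A i)) -> cylinder_prob k n A s <= 1.
Proof.
elim: n A s => [|n IH] A s mA /=.
  by rewrite lee_fin indicE; case: (_ \in _).
rewrite -(mule1 1); apply: lee_pmul; rewrite ?lee_fin ?indic_le1//.
- by apply: integral_ge0 => t _; exact: cylinder_prob_ge0.
- rewrite -(@prob_kernel _ _ _ _ _ k s) -[leRHS]mul1e -integral_cst//.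
  apply: ge0_le_integral => //.
  + by move=> t _; exact: cylinder_prob_ge0.
  + by apply: measurable_cylinder_prob => i.
  + by move=> t _; apply: IH => i.
Qed.

End cylinder_prob.

(** * Mixtures of probability measures *)

Section mixture.
Context (R : realType) (d d' : measure_display).
Context (T : measurableType d) (U : measurableType d').
Variables (f : T -> probability U R).
Hypothesis mf : forall B, measurable B -> measurable_fun setT (f ^~ B).

Lemma measurable_mixture : measurable_fun setT (f : T -> giry U R).
Proof. exact: measurable_giry_codensity. Qed.

(** The law of a point drawn from [f s] with [s] drawn from [mu]. As a bind of the Giry monad it
    inherits its measure structure and its integration formula. *)
Definition mixture (mu : probability T R) : set U -> \bar R :=
  giry_bind (mu : giry T R) measurable_mixture.

HB.instance Definition _ mu := Measure.on (mixture mu).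

Let mixture_setT mu : mixture mu setT = 1.
Proof.
transitivity (\int[mu]_s f s setT).
  rewrite [LHS]ge0_integral_pushforward//; first exact: measurable_mixture.
  exact: measurable_giry_ev.
under eq_integral do rewrite probability_setT.
by rewrite integral_cst// mul1e; exact: probability_setT.
Qed.

HB.instance Definition _ mu := Measure_isProbability.Build _ _ _
  (mixture mu) (mixture_setT mu).

Lemma mixtureE mu B : measurable B -> mixture mu B = \int[mu]_s f s B.
Proof.
move=> mB; rewrite [LHS]ge0_integral_pushforward//; first exact: measurable_mixture.
exact: measurable_giry_ev.
Qed.

Lemma integral_mixture mu (h : U -> \bar R) :
  measurable_fun setT h -> (forall x, 0 <= h x) ->
  \int[mixture mu]_x h x = \int[mu]_s \int[f s]_x h x.
Proof. by move=> mh h0; exact: giry_int_bind. Qed.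

End mixture.

Section pker_prob.
Context (R : realType) (d d' : measure_display).
Context (T : measurableType d) (U : measurableType d') (k : R.-pker T ~> U).

Definition pker_prob (s : T) : set U -> \bar R := k s.

HB.instance Definition _ s := Measure.on (pker_prob s).

HB.instance Definition _ s := Measure_isProbability.Build _ _ _
  (pker_prob s) (@prob_kernel _ _ _ _ _ k s).

End pker_prob.

(** * The Markov property at fixed times, and almost sure hitting *)

Section laws.
Context (R : realType) (d : measure_display) (S : measurableType d).
Variable k : R.-pker S ~> S.
Implicit Types (mu : probability S R) (P : probability (path_space S) R).

Lemma path_law_init mu P B : is_path_law k mu P -> measurable B ->
  P [set w | B (w 0%N)] = mu B.
Proof.
move=> lawP mB.
rewrite (_ : [set _ | _] = cylinder 0 (fun=> B)).
  by rewrite lawP// /= integral_indic// setIT.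
by apply/seteqP; split=> w /= => [Bw [|]//|/(_ 0%N)]; exact.
Qed.

Lemma path_law_two mu P A B : is_path_law k mu P ->
  measurable A -> measurable B ->
  P [set w | A (w 0%N) /\ B (w 1%N)] = \int[mu]_(s in A) k s B.
Proof.
move=> lawP mA mB.
rewrite (_ : [set _ | _] = cylinder 1 (fun i => if i is 0 then A else B)).
  rewrite lawP//=; last by case.
  rewrite [RHS]integral_mkcond; apply: eq_integral => s _.
  rewrite integral_indic// setIT patchE indicE; case: ifP => _.
  - by rewrite mul1e.
  - by rewrite mul0e.
apply/seteqP; split=> w /= => [[Aw Bw] [|[|]]//|h].
by split; [exact: (h 0%N)|exact: (h 1%N)].
Qed.

Lemma path_law_next mu P B : is_path_law k mu P -> measurable B ->
  P [set w | B (w 1%N)] = \int[mu]_s k s B.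
Proof.
move=> lawP mB; rewrite -(path_law_two lawP measurableT mB).
by congr (P _); apply/seteqP; split=> w //= [].
Qed.

(** A cylinder for the shifted path is a cylinder with no constraint at time 0. Its probability is
    an iterated integral over [mu] and [k], hence one integral against the mixture of the [k s],
    which is the law of the state at time 1. *)
Lemma path_law_shift1 mu P : is_path_law k mu P ->
  is_path_law k (distribution P (path_eval 1)) (distribution P (path_shift 1)).
Proof.
move=> lawP n A mA.
transitivity (P (cylinder n.+1 (fun i => if i is j.+1 then A j else setT))).
  congr (P _); apply/seteqP; split=> w /= h => [[|i] // |i]; first exact: h.
  by move=> lin; exact: (h i.+1).
rewrite lawP/=; last by case.
under eq_integral do rewrite indicT mul1e.
rewrite (_ : (fun i => A i) = A)//.
have mc := measurable_cylinder_prob k n mA.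
have c0 := cylinder_prob_ge0 k n A.
rewrite -(@integral_mixture _ _ _ _ _ (pker_prob k) (measurable_kernel k) mu _ mc c0).
apply: eq_measure_integral => B mB _.
rewrite [LHS](@mixtureE _ _ _ _ _ (pker_prob k) (measurable_kernel k) mu _ mB).
exact/esym/(path_law_next lawP).
Qed.

Lemma path_law_shift n mu P : is_path_law k mu P ->
  is_path_law k (distribution P (path_eval n)) (distribution P (path_shift n)).
Proof.
elim: n mu P => [|n IH] mu P lawP.
  move=> m A mA; rewrite [LHS](lawP _ _ mA).
  apply: eq_measure_integral => B mB _.
  exact/esym/(path_law_init lawP).
move=> m A mA; rewrite [LHS](IH _ _ (path_law_shift1 lawP) m A mA).
exact: eq_measure_integral.
Qed.

(** The events of avoiding [B] up to time [n] decrease to the event of never hitting [B]. *)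
Lemma path_law_hit mu P B : is_path_law k mu P -> measurable B ->
  P (eventually_in B) = 1 <->
  \int[mu]_s cylinder_prob k n (fun=> ~` B) s @[n --> \oo] --> 0.
Proof.
move=> lawP mB; have mBC := measurableC mB.
have mF := measurable_eventually_in mB.
rewrite (_ : (fun n => _) = P \o (fun n => cylinder n (fun=> ~` B))); last first.
  by apply/funext => n; rewrite /= lawP.
have cv : P \o (fun n => cylinder n (fun=> ~` B)) @ \oo --> P (~` eventually_in B).
  rewrite (_ : ~` eventually_in B = \bigcap_n cylinder n (fun=> ~` B)); last first.
    apply/seteqP; split=> w.
    - by move=> nF n _ i _ Bi; apply: nF; exists i.
    - by move=> h [i Bi]; exact: (h i I i).
  apply: nonincreasing_cvg_mu.
  - by rewrite ltey_eq fin_num_measure//; exact: measurable_cylinder.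
  - by move=> i; exact: measurable_cylinder.
  - by apply: bigcapT_measurable => n; exact: measurable_cylinder.
  - move=> m n mn; apply/subsetPset => w h i im; apply: h; exact: leq_trans mn.
rewrite probability_setC// in cv.
split=> [F1|cv0]; first by rewrite F1 subee in cv.
have /eqP : 1 - P (eventually_in B) = 0.
  exact: (cvg_unique (@ereal_hausdorff R) cv cv0).
by rewrite sube_eq ?fin_num_measure// add0e => /eqP/esym.
Qed.

End laws.

(** * Finite maxima and null sets in countable spaces *)

Lemma finite_set_argmax (R : realDomainType) (T : choiceType) (X : set T)
    (f : T -> \bar R) :
  finite_set X -> X !=set0 -> exists2 a, X a & forall b, X b -> f b <= f a.
Proof.
move=> /finite_seqP[s ->]; elim: s => [|x s IH]; first by case.
move=> _; have [s0|/eqP s0] := pselect (s = [::]).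
  by exists x => [|b] /=; rewrite ?s0 ?inE// => /eqP ->.
have [|a /= sa am] := IH.
  by case: s s0 {IH} => // y s _; exists y; rewrite /= inE eqxx.
have [xa|ax] := leP (f x) (f a).
- exists a => /= [|b]; rewrite ?inE ?sa ?orbT//.
  by move=> /orP[/eqP ->//|]; exact: am.
- exists x => /= [|b]; rewrite ?inE ?eqxx//.
  by move=> /orP[/eqP ->//|/am ba]; exact: le_trans (ltW ax).
Qed.

Lemma countable_null (R : realType) (d : measure_display) (U : measurableType d)
    (mu : {measure set U -> \bar R}) (B : set U) :
  countable [set: U] -> (forall A : set U, measurable A) ->
  (forall y, B y -> mu [set y] = 0) -> mu B = 0.
Proof.
move=> /countable_injP[f injf] mU B0.
rewrite (_ : B = \bigcup_n (B `&` f @^-1` [set n])); last first.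
  by rewrite -setI_bigcupr -preimage_bigcup bigcup_imset1 image_id preimage_setT setIT.
apply/negligibleP; first exact: mU.
apply: negligible_bigcup => n; apply/negligibleP; first exact: mU.
have [[y [By fy]]|] := pselect ((B `&` f @^-1` [set n]) !=set0).
  rewrite (_ : _ `&` _ = [set y]); first exact: B0.
  apply/seteqP; split=> [z [Bz fz]|_ -> //].
  by apply: injf; rewrite ?inE// fz fy.
by move=> /set0P/negP/negPn/eqP ->.
Qed.

(** * Escape probabilities and reachability in a countable chain *)

Section discrete.
Context (R : realType) (d : measure_display) (U : measurableType d).
Variable k : R.-pker U ~> U.

Definition avoid (B : set U) (n : nat) (t : U) : \bar R :=
  cylinder_prob k n (fun=> ~` B) t.

(** The probability of never hitting [B] from [t], as the limit of the decreasing [avoid B n t].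
    Built from [cylinder_prob], it presupposes no path law started in [t]. *)
Definition escape (B : set U) (t : U) : \bar R :=
  ereal_inf (range (avoid B ^~ t)).

Definition step_closed (C : set U) :=
  forall x y, C x -> 0 < k x [set y] -> C y.

(** The reflexive transitive closure of the steps of positive probability, given as the least closed
    set containing [t]. *)
Definition reach (t : U) : set U :=
  [set u | forall C, step_closed C -> C t -> C u].

Lemma reach_refl t : reach t t. Proof. by move=> C _. Qed.

Lemma reach_trans x y z : reach x y -> reach y z -> reach x z.
Proof. by move=> xy yz C cC Cx; apply: yz => //; exact: xy. Qed.

Lemma reach_sub C x y : step_closed C -> C x -> reach x y -> C y.
Proof. by move=> cC Cx; exact. Qed.

Lemma step_closed_reach t : step_closed (reach t).
Proof. by move=> x y tx xy C cC Ct; apply: (cC x) => //; exact: tx. Qed.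

Hypotheses (mU : forall A : set U, measurable A) (cU : countable [set: U]).

Let mfU (f : U -> \bar R) : measurable_fun setT f.
Proof. by move=> _ Y _; exact: mU. Qed.

Lemma avoid_ge0 B n t : 0 <= avoid B n t.
Proof. exact: cylinder_prob_ge0. Qed.

Lemma avoid_le1 B n t : avoid B n t <= 1.
Proof. by apply: cylinder_prob_le1. Qed.

Lemma avoid_in B n t : B t -> avoid B n t = 0.
Proof.
move=> Bt; have e : (\1_(~` B) t)%:E = 0 :> \bar R.
  by rewrite indicE memNset//=; exact.
by case: n => [|n]; rewrite /avoid /= e ?mul0e.
Qed.

Lemma avoidS B n t : ~ B t -> avoid B n.+1 t = \int[k t]_s avoid B n s.
Proof. by move=> Bt; rewrite /avoid /= indicE mem_set// mul1e. Qed.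

Lemma avoid_nincr B t : nonincreasing_seq (avoid B ^~ t).
Proof.
apply/nonincreasing_seqP => n; elim: n t => [|n IH] t.
  have [Bt|Bt] := pselect (B t); first by rewrite !avoid_in.
  by rewrite [leRHS]/avoid /= indicE mem_set//= avoid_le1.
have [Bt|Bt] := pselect (B t); first by rewrite !avoid_in.
rewrite !avoidS//; apply: ge0_le_integral => //= s _; exact: avoid_ge0.
Qed.

Lemma escape_cvg B t : avoid B n t @[n --> \oo] --> escape B t.
Proof. exact/ereal_nonincreasing_cvgn/avoid_nincr. Qed.

Lemma escape_le_avoid B n t : escape B t <= avoid B n t.
Proof. by apply: ereal_inf_lbound; exists n. Qed.

Lemma le_escape B t (x : \bar R) : (forall n, x <= avoid B n t) -> x <= escape B t.
Proof. by move=> h; apply: le_ereal_inf_tmp => _ [n _ <-]. Qed.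

Lemma escape_ge0 B t : 0 <= escape B t.
Proof. by apply: le_escape => n; exact: avoid_ge0. Qed.

Lemma escape_le1 B t : escape B t <= 1.
Proof. exact: le_trans (escape_le_avoid B 0 t) (avoid_le1 _ _ _). Qed.

Lemma escape_in B t : B t -> escape B t = 0.
Proof.
move=> Bt; apply/eqP; rewrite eq_le escape_ge0 andbT.
by rewrite -(avoid_in 0 Bt) escape_le_avoid.
Qed.

Lemma integral_avoid_cvg (mu : probability U R) B :
  \int[mu]_s avoid B n s @[n --> \oo] --> \int[mu]_s escape B s.
Proof.
have [] := @dominated_convergence _ _ _ mu setT measurableT (avoid B) (escape B)
  (cst 1) => //.
- by apply: aeW => x _; exact: escape_cvg.
- exact: finite_measure_integrable_cst.
- by apply: aeW => x n _; rewrite gee0_abs ?avoid_ge0 ?avoid_le1.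
Qed.

(** The one-step equation for [avoid] passes to the limit by dominated convergence. *)
Lemma escape_subharmonic B t : ~ B t -> escape B t <= \int[k t]_s escape B s.
Proof.
move=> Bt; have cv := @integral_avoid_cvg (pker_prob k t) B.
rewrite -(cvg_lim _ cv)//; apply: lime_ge; first by apply/cvg_ex; eexists; exact: cv.
apply: nearW => n; rewrite [leRHS](_ : _ = avoid B n.+1 t) ?escape_le_avoid//.
by rewrite avoidS.
Qed.

Lemma step_closed_null C t : step_closed C -> C t -> k t (~` C) = 0.
Proof.
move=> cC Ct; apply: countable_null => // y Cy; apply/eqP.
rewrite eq_le measure_ge0 andbT leNgt; apply/negP => ty.
by apply: Cy; exact: cC ty.
Qed.

(** The chain almost surely never leaves [reach t]. If this set missed [B], then [avoid B n t] would
    be 1 for every [n]. *)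
Lemma reach_meets B t : escape B t = 0 -> exists2 a, B a & reach t a.
Proof.
move=> Bt0; apply: contrapT => nB.
have dB s : reach t s -> ~ B s by move=> ts Bs; apply: nB; exists s.
suff : 1 <= escape B t by rewrite Bt0 lee_fin ler10.
apply: le_escape => n.
suff: forall s, reach t s -> 1 <= avoid B n s by apply; exact: reach_refl.
elim: n => [|n IH] s ts.
  by rewrite /avoid /= indicE mem_set//; exact: dB.
rewrite avoidS; last exact: dB.
rewrite -(@prob_kernel _ _ _ _ _ k s) -[leLHS]mul1e -integral_cst//.
apply: ae_ge0_le_integral => //; first by move=> x _; exact: avoid_ge0.
exists (~` reach t); split=> //.
  by apply: step_closed_null => //; exact: step_closed_reach.
by move=> x /= nx tx; apply: nx => _; exact: IH.
Qed.

(** Maximum principle: [escape B] attains its maximum over [Re] at a state [a] of the finite set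
    [A]. The maximum propagates along steps, so it is also the value at a state of [B] reachable
    from [a], which is 0. *)
Lemma escape_eq0 (Re A B : set U) : step_closed Re -> finite_set A ->
  (forall t, Re t -> escape A t = 0) ->
  (forall t, Re t -> exists2 u, reach t u & B u) ->
  forall t, Re t -> escape B t = 0.
Proof.
move=> cRe fA A0 hB t0 Ret0.
have [a0 Aa0 ta0] := reach_meets (A0 _ Ret0).
have [||a [Aa Rea] am] := @finite_set_argmax R _ (A `&` Re) (escape B).
- by apply: sub_finite_set fA => x [].
- by exists a0; split => //; exact: ta0.
set m := escape B a in am.
have m0 : 0 <= m by exact: escape_ge0.
have mfin : m \is a fin_num.
  by rewrite ge0_fin_numE// (le_lt_trans (escape_le1 _ _))// ltry.
(* [escape B] is subharmonic off [B], hence bounded by its maximum on the attractor. *)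
have le_m t : Re t -> escape B t <= m.
  (* The added 0 is rewritten as [escape A t], so it suffices to bound [escape B t] by
     [m + avoid A n t] for each [n], by induction on [n]: until [A] is hit the error term pays, and
     on [A] the bound is [m]. *)
  move=> Ret; rewrite -[leRHS]adde0 -(A0 _ Ret) -leeBlDl//.
  apply: le_escape => n; rewrite leeBlDl//.
  elim: n t Ret => [|n IH] t Ret.
    have [At|At] := pselect (A t).
      by rewrite avoid_in// adde0; exact: am.
    rewrite /avoid /= indicE mem_set//; apply: le_trans (escape_le1 _ _) _.
    by rewrite -[leLHS]add0e leeD2r.
  have [At|At] := pselect (A t); first by rewrite avoid_in// adde0; exact: am.
  have [Bt|Bt] := pselect (B t); first by rewrite escape_in// adde_ge0// avoid_ge0.
  rewrite avoidS//; apply: le_trans (escape_subharmonic Bt) _.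
  apply: le_trans (_ : \int[k t]_s (m + avoid A n s) <= _).
    apply: ae_ge0_le_integral => //.
    - by move=> x _; exact: escape_ge0.
    - by move=> x _; rewrite adde_ge0// avoid_ge0.
    exists (~` Re); split=> //; first exact: step_closed_null.
    by move=> x /= nx Rex; apply: nx => _; exact: IH.
  rewrite ge0_integralD//; last by move=> x _; exact: avoid_ge0.
  by rewrite integral_cst// (prob_kernel t) mule1.
suff m00 : m = 0 by apply/eqP; rewrite eq_le escape_ge0 andbT -m00 le_m.
apply: contrapT => mN0.
have [u au Bu] := hB _ Rea.
(* The points of [Re] where [escape B] is maximal form a closed set. *)
have [|//|_] := au (Re `&` [set x | escape B x = m]).
  move=> x y [Rex xm] xy; have Rey := cRe _ _ Rex xy.
  split=> //=; apply/eqP; rewrite eq_le le_m//= leNgt; apply/negP => ym.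
  have Bx : ~ B x by move=> Bx; apply: mN0; rewrite -xm escape_in.
  have yfin : escape B y \is a fin_num.
    by rewrite ge0_fin_numE ?escape_ge0// (le_lt_trans (escape_le1 _ _))// ltry.
  have d0 : 0 < m - escape B y by rewrite sube_gt0.
  (* The deficit of [escape B] at [y] is added back, which keeps the integrand below [m] on [Re].
     With subharmonicity at [x], the positive quantity [(m - escape B y) * k x [set y]] would be at
     most 0. *)
  have : \int[k x]_s (escape B s + (m - escape B y) * (\1_[set y] s)%:E) <= m.
    rewrite -[leRHS]mule1 -(@prob_kernel _ _ _ _ _ k x) -integral_cst//.
    apply: ae_ge0_le_integral => //.
    - by move=> s _; rewrite adde_ge0 ?escape_ge0// mule_ge0 ?lee_fin ?(ltW d0).
    exists (~` Re); split=> //; first exact: step_closed_null.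
    move=> s /= ns Res; apply: ns => _; rewrite indicE.
    have [->|sy] := eqVneq s y.
      by rewrite mem_set// mule1 addeC subeK.
    by rewrite memNset ?mule0 ?adde0 ?le_m//=; exact/eqP.
  rewrite ge0_integralD//; last 2 first.
  - by move=> s _; exact: escape_ge0.
  - by move=> s _; rewrite mule_ge0 ?lee_fin ?(ltW d0).
  rewrite ge0_integralZl ?(ltW d0)// integral_indic// setIT => hm.
  have := escape_subharmonic Bx; rewrite xm => /(leeD2r ((m - escape B y) * k x [set y])).
  move=> /le_trans/(_ hm); rewrite -[leRHS]adde0 leeD2lE// leNgt mule_gt0//.
by rewrite /= escape_in// => /esym.
Qed.

(** Almost sure hitting means that [escape B] has integral 0 under [mu]; in a countable space this
    is its vanishing at every atom. *)
Lemma path_law_hit_escape (mu : probability U R) (P : probability (path_space U) R) B :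
  is_path_law k mu P ->
  P (eventually_in B) = 1 <-> forall t, 0 < mu [set t] -> escape B t = 0.
Proof.
move=> lawP; rewrite (path_law_hit lawP)//.
have cv := @integral_avoid_cvg mu B.
have -> : \int[mu]_s cylinder_prob k n (fun=> ~` B) s @[n --> \oo] --> 0 <->
    \int[mu]_s escape B s = 0.
  split=> [cv0|<-//]; exact: (cvg_unique (@ereal_hausdorff R) cv cv0).
split=> [i0 t mut|h].
  apply/eqP; rewrite eq_le escape_ge0 andbT leNgt; apply/negP => et.
  have : \int[mu]_s (escape B t * (\1_[set t] s)%:E) <= \int[mu]_s escape B s.
    apply: ge0_le_integral => //.
    - by move=> s _; rewrite mule_ge0 ?escape_ge0 ?lee_fin.
    move=> s _; rewrite indicE; have [->|st] := eqVneq s t.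
      by rewrite mem_set// mule1.
    by rewrite memNset ?mule0 ?escape_ge0//=; exact/eqP.
  rewrite i0 ge0_integralZl ?escape_ge0// integral_indic// setIT leNgt mule_gt0//.
rewrite (ae_eq_integral (cst 0)) ?integral0//.
exists [set t | escape B t <> 0]; split=> //.
  apply: countable_null => // t et0; apply/eqP; rewrite eq_le measure_ge0 andbT leNgt.
  by apply/negP => /h.
by move=> t /= /not_implyP[].
Qed.

End discrete.

(** * Changing the initial distribution of a path law *)

Section change_of_initial_law.
Context (R : realType) (d : measure_display) (U : measurableType d).
Variable k : R.-pker U ~> U.
Hypotheses (mU : forall A : set U, measurable A) (cU : countable [set: U]).

(** Conditioning on the initial state: the event [w 0 = t] merges into the constraint at time 0, and
    dividing by the mass of [t] leaves the chain started in [t]. This mass is positive, so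
    [mnormalize] does not return its default [P]. *)
Lemma path_law_cond (mu : probability U R) (P : probability (path_space U) R)
    (t : U) (mt : measurable [set w : path_space U | w 0%N = t]) :
  is_path_law k mu P -> 0 < mu [set t] ->
  forall n A, mnormalize (mrestr P mt) P (cylinder n A) = cylinder_prob k n A t.
Proof.
move=> lawP t0 n A.
have tfin : mu [set t] \is a fin_num by rewrite fin_num_measure.
have ev : mrestr P mt setT = mu [set t].
  by rewrite /mrestr setTI -(path_law_init lawP (mU [set t])).
have -> : mnormalize (mrestr P mt) P (cylinder n A) =
    mrestr P mt (cylinder n A) * (fine (mu [set t]))^-1%:E.
  rewrite /mnormalize /= ev gt_eqF//= ifF//; apply/negbTE.
  by rewrite -ltey ltey_eq tfin.
have -> : mrestr P mt (cylinder n A) =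
    P (cylinder n (fun i => if i is 0 then A 0%N `&` [set t] else A i)).
  congr (P _); apply/seteqP; split=> w /=.
    by move=> [h wt] [|i] // lin; [split => //; exact: h|exact: h].
  by move=> h; split=> [[|i] lin|]; [case: (h 0%N lin)|exact: (h i.+1)|case: (h 0%N isT)].
rewrite lawP; last by [].
transitivity (\int[mu]_s (cylinder_prob k n A t * (\1_[set t] s)%:E)
    * (fine (mu [set t]))^-1%:E).
  congr (_ * _); apply: eq_integral => s _.
  have -> : cylinder_prob k n (fun i => if i is 0 then A 0%N `&` [set t] else A i) s =
      (\1_[set t] s)%:E * cylinder_prob k n A s.
    case: n => [|n] /=; rewrite indicI EFinM; first by rewrite muleC.
    by rewrite [X in X * _]muleC muleA.
  rewrite indicE; have [->|st] := eqVneq s t; first by rewrite mem_set// mul1e mule1.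
  by rewrite memNset ?mul0e ?mule0//=; exact/eqP.
rewrite ge0_integralZl//; last first.
- exact: cylinder_prob_ge0.
rewrite integral_indic// setIT -[X in _ * X * _](fineK tfin) -muleA -EFinM divff ?mule1//.
by rewrite gt_eqF// fine_gt0// t0 ltey_eq tfin.
Qed.

(** The required law is the [nu]-mixture of the conditional laws of [P] given the initial state. *)
Lemma path_law_abs_cont (mu nu : probability U R) (P : probability (path_space U) R) :
  is_path_law k mu P -> (forall t, 0 < nu [set t] -> 0 < mu [set t]) ->
  exists P' : probability (path_space U) R, is_path_law k nu P'.
Proof.
move=> lawP numu.
have mt t : measurable [set w : path_space U | w 0%N = t].
  exact: (measurable_eval_preimage 0 (mU [set t])).
(* At states of [mu]-mass 0, [K t] is the default [P]; such states have [nu]-mass 0 as well. *)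
pose K t : probability (path_space U) R := mnormalize (mrestr P (mt t)) P.
have mK B : measurable B -> measurable_fun setT (K ^~ B) by move=> _ _ Y _; exact: mU.
exists (mixture mK nu) => n A mA.
rewrite [LHS](mixtureE mK); last exact: measurable_cylinder.
apply: ae_eq_integral => //.
exists [set t | nu [set t] = 0]; split=> //; first exact: countable_null.
move=> t /= /not_implyP[_ ne]; apply: contrapT => nut.
apply: ne; apply: path_law_cond lawP _ _ _; apply: numu.
by rewrite lt0e measure_ge0 andbT; exact/eqP.
Qed.

End change_of_initial_law.

(** * Images of path laws under maps compatible with the kernels *)

Section lumping.
Context (R : realType) (d d' : measure_display).
Context (S : measurableType d) (S' : measurableType d').
Variables (k : R.-pker S ~> S) (k' : R.-pker S' ~> S') (f : {mfun S >-> S'}).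
Hypothesis kf : forall s B, measurable B -> k s (f @^-1` B) = k' (f s) B.

Lemma cylinder_prob_lumping n (A : nat -> set S') s : (forall i, measurable (A i)) ->
  cylinder_prob k n (fun i => f @^-1` A i) s = cylinder_prob k' n A (f s).
Proof.
elim: n A s => [//|n IH] A s mA /=; congr (_ * _).
transitivity (\int[k s]_t (cylinder_prob k' n (fun i => A i.+1) \o f) t).
  by apply: eq_integral => t _; rewrite /= -IH.
have mc : measurable_fun setT (cylinder_prob k' n (fun i => A i.+1)).
  exact: measurable_cylinder_prob.
rewrite -[LHS](@ge0_integral_pushforward _ _ _ _ _ _ (measurable_funPT f) (k s) setT)//.
  by apply: eq_measure_integral => B mB _; exact: kf.
by move=> t _; exact: cylinder_prob_ge0.
Qed.

Lemma path_law_lumping (mu : probability S R) (P : probability (path_space S) R) :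
  is_path_law k mu P ->
  is_path_law k' (distribution mu f) (distribution P (pathwise f)).
Proof.
move=> lawP n A mA.
transitivity (P (cylinder n (fun i => f @^-1` A i))); first by [].
rewrite lawP; last first.
  by move=> i; rewrite -[X in measurable X]setTI; exact: measurable_funPT.
rewrite ge0_integral_distribution; last 2 first.
- exact: measurable_cylinder_prob.
- exact: cylinder_prob_ge0.
by apply: eq_integral => s _; exact: cylinder_prob_lumping.
Qed.

End lumping.

(** * Almost sure statements *)

Lemma probability1_ae (R : realType) (d : measure_display) (T : measurableType d)
    (P : probability T R) (E : set T) : measurable E ->
  P E = 1 <-> {ae P, forall w, E w}.
Proof.
move=> mE; have mEC := measurableC mE.
split=> [E1|aeE].
- by exists (~` E); split; rewrite // [LHS]probability_setC// E1 subee.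
- have /(negligibleP P mEC) PE : P.-negligible (~` E) by exact: aeE.
  have := probability_setC P mE; rewrite PE => /esym/eqP.
  by rewrite sube_eq ?fin_num_measure// add0e => /eqP/esym.
Qed.

Lemma ae_forall_countable (R : realType) (d : measure_display)
    (T : measurableType d) (mu : {measure set T -> \bar R}) (U : Type)
    (Q : U -> T -> Prop) : countable [set: U] ->
  (forall u, {ae mu, forall w, Q u w}) -> {ae mu, forall w, forall u, Q u w}.
Proof.
move=> /countable_injP[f injf] hQ.
have : {ae mu, forall w, forall n u, f u = n -> Q u w}.
  apply: ae_foralln => n.
  have [[v fv]|nv] := pselect (exists v, f v = n).
  - apply: filterS (hQ v) => w Qv u fu.
    by have -> : u = v by apply: injf; rewrite ?in_setT ?fu ?fv.
  - by apply: aeW => w u fu; case: nv; exists u.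
by apply: filterS => w h u; exact: h.
Qed.

(** * Recurrent classes and the colours seen infinitely often *)

Section recurrence.
Context (R : realType) (d : measure_display) (U : measurableType d).
Variable k : R.-pker U ~> U.
Variables (A Re : set U).
Hypotheses (mU : forall A : set U, measurable A) (cU : countable [set: U]).

Definition recurrent : set U :=
  [set a | [/\ A a, Re a & forall u, reach k a u -> reach k u a]].

(** Among the states of [A] in [Re] reachable from [t], take [a] reaching the fewest states of [A].
    Any [u] reachable from [a] reaches some [x] in [A]; by minimality [x] reaches the same states of
    [A] as [a], in particular [a] itself. *)
Lemma recurrent_reachable t : finite_set A -> step_closed k Re ->
  (forall t, Re t -> escape k A t = 0) ->
  Re t -> exists2 a, reach k t a & recurrent a.
Proof.
move=> fA cRe A0 Ret.
pose X x := fset_set (reach k x `&` A).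
have fX x : finite_set (reach k x `&` A) by apply: sub_finite_set fA => y [].
have [||a [Aa Rea ta] am] := @finite_set_argmax R _ [set x | [/\ A x, Re x & reach k t x]]
    (fun x => (- (#|` X x|%:R : R))%:E).
- by apply: sub_finite_set fA => x [].
- have [x Ax tx] := reach_meets mU cU (A0 _ Ret).
  by exists x; split=> //; exact: (reach_sub cRe Ret).
exists a => //; split=> // u au.
have [x Ax ux] := reach_meets mU cU (A0 _ (reach_sub cRe Rea au)).
have ax := reach_trans au ux.
have /eqP XE : X x == X a.
  rewrite eqEfcard; apply/andP; split.
    apply/fsubsetP => y; rewrite !in_fset_set// !inE => -[xy Ay].
    by split=> //; exact: reach_trans xy.
  have /am : [/\ A x, Re x & reach k t x].
    by split=> //; [exact: (reach_sub cRe Rea)|exact: reach_trans ax].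
  by rewrite lee_fin lerN2 ler_nat.
have : a \in X x by rewrite XE in_fset_set// inE; split=> //; exact: reach_refl.
by rewrite in_fset_set// inE => -[xa _]; exact: reach_trans xa.
Qed.

Context (Q : finType) (col : U -> Q).

Definition inf_colours (x : nat -> U) : {set Q} :=
  [set q : Q | `[< forall n, exists2 m, (n <= m)%N & col (x m) = q >]]%SET.

Definition class_colours (a : U) : {set Q} :=
  [set q : Q | `[< exists2 u, reach k a u & col u = q >]]%SET.

(** Once inside [reach k a] the sequence cannot leave, so the second hypothesis forces a visit to
    every state of the class after any given time. *)
Lemma inf_colours_class (x : nat -> U) a :
  (forall n, reach k a (x n) -> reach k a (x n.+1)) ->
  (forall c n, reach k a c -> exists2 i, (n <= i)%N & ~ reach k a (x i) \/ x i = c) ->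
  (exists n, reach k a (x n)) -> inf_colours x = class_colours a.
Proof.
move=> stay visit [n0 an0].
have an m : (n0 <= m)%N -> reach k a (x m).
  elim: m => [|m IH]; first by rewrite leqn0 => /eqP <-.
  by rewrite leq_eqVlt => /orP[/eqP <- //|/IH/stay].
apply/setP => q; rewrite !inE; apply/asboolP/asboolP => [/(_ n0)[m nm <-]|[u au <-] n].
  by exists (x m) => //; exact: an.
have [i + [|<-]] := visit u (maxn n n0) au.
  by rewrite geq_max => /andP[_ /an ai] /(_ ai).
by rewrite geq_max => /andP[ni _]; exists i.
Qed.

Context (d' : measure_display) (V : measurableType d').
Variables (P : probability (path_space V) R) (b : {mfun V >-> U}).

Let mb n (B : set U) : measurable [set w : path_space V | B (b (w n))].
Proof.
apply: (measurable_eval_preimage n (B := b @^-1` B)).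
by rewrite -[X in measurable X]setTI; exact: measurable_funPT.
Qed.

(** The event is a finite union over [X] in [F] of finite intersections over the colours of limsup
    events or their complements. *)
Lemma measurable_inf_colours (F : {set {set Q}}) :
  measurable [set w : path_space V | inf_colours (b \o w) \in F].
Proof.
have mq (X : {set Q}) (q : Q) : measurable
    [set w : path_space V | (q \in inf_colours (b \o w)) = (q \in X)].
  have mE : measurable [set w : path_space V | q \in inf_colours (b \o w)].
    rewrite (_ : [set _ | _] = \bigcap_n \bigcup_(m in [set m | (n <= m)%N])
        [set w : path_space V | col (b (w m)) = q]).
      apply: bigcapT_measurable => n; apply: bigcup_measurable => m _.
      exact: (mb m [set u | col u = q]).
    apply/seteqP; split=> w /=; rewrite inE.
      by move=> /asboolP h n _; have [m nm e] := h n; exists m.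
    by move=> h; apply/asboolP => n; have [m nm e] := h n I; exists m.
  have [qX|qX] := boolP (q \in X); first exact: mE.
  rewrite (_ : [set _ | _] = ~` [set w : path_space V | q \in inf_colours (b \o w)]).
    exact: measurableC.
  by apply/seteqP; split=> w /= => [-> //|/negP/negbTE].
rewrite (_ : [set _ | _] = \bigcup_(X in [set X | X \in F]) \bigcap_(q in [set: Q])
    [set w : path_space V | (q \in inf_colours (b \o w)) = (q \in X)]).
  apply: fin_bigcup_measurable => [|X _]; first exact: finite_finset.
  by apply: fin_bigcap_measurable => [|q _]; [exact: finite_finset|exact: mq].
apply/seteqP; split=> w /=.
  by move=> wF; exists (inf_colours (b \o w)).
by move=> [X XF h]; rewrite (_ : inf_colours _ = X)//; apply/setP => q; exact: h.
Qed.

(** Paths in [V] are observed through [b], so that one statement serves both products. Almost every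
    path meets a recurrent state [a], and meeting it fixes the colours seen infinitely often as
    [class_colours a]. *)
Lemma inf_colours_recurrent (F : {set {set Q}}) :
  (forall t, Re t -> exists2 a, reach k t a & recurrent a) ->
  (forall a, recurrent a -> exists n, 0 < P [set w | b (w n) = a]) ->
  (forall n B, (forall t, Re t -> exists2 u, reach k t u & B u) ->
    P [set w | exists2 i, (n <= i)%N & B (b (w i))] = 1) ->
  (forall n C, step_closed k C -> P [set w | C (b (w n)) /\ ~ C (b (w n.+1))] = 0) ->
  P [set w | inf_colours (b \o w) \in F] = 1 <->
  forall a, recurrent a -> class_colours a \in F.
Proof.
move=> hrec hpos hvisit hstay.
have mvisit n B : measurable [set w : path_space V | exists2 i, (n <= i)%N & B (b (w i))].
  rewrite (_ : [set _ | _] =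
      \bigcup_(i in [set i | (n <= i)%N]) [set w : path_space V | B (b (w i))]).
    by apply: bigcup_measurable => i _; exact: mb.
  by apply/seteqP; split=> w [i]; exists i.
have ae1 : {ae P, forall w, exists i, recurrent (b (w i))}.
  have /(probability1_ae _ (mvisit _ _)) := hvisit 0%N _ hrec.
  by apply: filterS => w [i _]; exists i.
have ae2 : {ae P, forall w, forall a n,
    reach k a (b (w n)) -> reach k a (b (w n.+1))}.
  apply: ae_forall_countable => // a; apply: ae_foralln => n.
  exists [set w | reach k a (b (w n)) /\ ~ reach k a (b (w n.+1))]; split.
  - by apply: measurableI; [exact: (mb n)|exact: (mb n.+1 (~` _))].
  - by apply: (hstay n (reach k a)); exact: step_closed_reach.
  - by move=> w /= /not_implyP.
have ae3 : {ae P, forall w, forall a c n, recurrent a -> reach k a c ->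
    exists2 i, (n <= i)%N & ~ reach k a (b (w i)) \/ b (w i) = c}.
  apply: ae_forall_countable => // a; apply: ae_forall_countable => // c.
  apply: ae_foralln => n.
  have [ra|] := pselect (recurrent a /\ reach k a c); last first.
    by move=> nra; apply: aeW => w ra ac; case: nra.
  case: ra => -[Aa Rea ra] ac.
  (* From inside the class, recurrence leads back to [a] and on to [c]; a state outside is already
     in the target set. *)
  have hv t : Re t -> exists2 u, reach k t u & ~ reach k a u \/ u = c.
    move=> Ret; have [at_|nat_] := pselect (reach k a t).
      by exists c; [exact: reach_trans (ra _ at_) ac|right].
    by exists t; [exact: reach_refl|left].
  have /(probability1_ae _ (mvisit _ [set u | ~ reach k a u \/ u = c])) := hvisit n _ hv.
  by apply: filterS => w h _ _.
have ae4 : {ae P, forall w, forall a n, recurrent a -> b (w n) = a ->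
    inf_colours (b \o w) = class_colours a}.
  move: ae2 ae3; apply: (@filterS2 _ _ (ae_filter_ringOfSetsType P)) => w h2 h3 a n ra wa.
  apply: inf_colours_class => [m|c m ac|].
  - exact: h2.
  - exact: h3.
  - by exists n; rewrite /= wa; exact: reach_refl.
rewrite (probability1_ae _ (measurable_inf_colours F)).
split=> [aeF a ra|hF].
- have [n wn] := hpos a ra; apply: contrapT => aF.
  (* Almost every path through [a] has the rejected set [class_colours a], while almost every path
     is accepted. *)
  suff : P [set w | b (w n) = a] = 0 by move=> w0; rewrite w0 ltxx in wn.
  apply/(negligibleP P (mb n [set a])).
  have [N [mN N0 sN]] : {ae P, forall w, ~ (b (w n) = a)}.
    move: aeF ae4; apply: (@filterS2 _ _ (ae_filter_ringOfSetsType P)) => w wF h wa.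
    by apply: aF; rewrite -(h a n).
  by exists N; split=> // w wa; apply: sN; exact.
- move: ae1 ae4; apply: (@filterS2 _ _ (ae_filter_ringOfSetsType P)) => w [n wn] h.
  by rewrite /= (h _ _ wn erefl); exact: hF.
Qed.

End recurrence.

HB.instance Definition _ (d : measure_display) (S : measurableType d) :=
  isMeasurableFun.Build _ _ _ _ (@idfun S) (@measurable_id _ S setT).

HB.instance Definition _ (d d' : measure_display) (S : measurableType d)
    (S' : measurableType d') :=
  isMeasurableFun.Build _ _ _ _ (@fst S S') measurable_fst.

(** * Null events, closed sets and visits at a given time *)

Section path_law_steps.
Context (R : realType) (d : measure_display) (S : measurableType d).
Variables (k : R.-pker S ~> S) (mu : probability S R).
Variable P : probability (path_space S) R.
Hypothesis lawP : is_path_law k mu P.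

(** The left probability is the integral of the nonnegative function [k s B] against the law at time
    [n], which is 0 exactly when the function vanishes almost everywhere. *)
Lemma path_law_step_null n (B : set S) : measurable B ->
  P [set w | B (w n.+1)] = 0 <-> P [set w | k (w n) B <> 0] = 0.
Proof.
move=> mB.
have mk : measurable_fun setT (fun s => k s B) by exact: measurable_kernel.
have mN : measurable [set s | k s B <> 0].
  rewrite (_ : [set _ | _] = setT `&` [set s | k s B != 0]).
    exact: emeasurable_neq.
  by rewrite setTI; apply/seteqP; split=> s /eqP.
have := path_law_next (path_law_shift n lawP) mB.
rewrite [LHS](_ : _ = P [set w | B (w n.+1)]) => [->|]; last first.
  by congr (P _); apply/seteqP; split=> w /=; rewrite /path_shift addn1.
have := @ae_eq_integral_abs _ _ _ (distribution P (path_eval n)) setT measurableT _ mk.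
under eq_integral do rewrite gee0_abs//.
move=> ->; split=> [h|h].
- apply: (negligibleP (distribution P (path_eval n)) mN).1.
  have [N [mN' N0 sN]] := h; exists N; split=> // s sB; apply: sN => /= /(_ I).
  exact: sB.
- exists [set s | k s B <> 0]; split=> //.
  by move=> s /= /not_implyP[].
Qed.

Lemma path_law_stay n (C : set S) : measurable C ->
  (forall s, C s -> k s (~` C) = 0) ->
  P [set w | C (w n) /\ ~ C (w n.+1)] = 0.
Proof.
move=> mC C0.
transitivity (distribution P (path_shift n) [set w | C (w 0%N) /\ (~` C) (w 1%N)]).
  by congr (P _); apply/seteqP; split=> w /=; rewrite /path_shift addn0 addn1.
rewrite (path_law_two (path_law_shift n lawP) mC (measurableC mC)).
by apply: integral0_eq => s Cs; exact: C0.
Qed.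

Lemma path_law_visit n (B : set S) :
  distribution P (path_shift n) (eventually_in B) =
  P [set w | exists2 i, (n <= i)%N & B (w i)].
Proof.
congr (P _); apply/seteqP; split=> w /= [i].
- by exists (n + i)%N => //; exact: leq_addr.
- by move=> ni Bi; exists (i - n)%N; rewrite /path_shift subnKC.
Qed.

End path_law_steps.

(** * The states charged at some time *)

Section support.
Context (R : realType) (d : measure_display) (U : measurableType d).
Variables (k : R.-pker U ~> U) (mu : probability U R).
Variable P : probability (path_space U) R.
Hypotheses (mU : forall A : set U, measurable A) (cU : countable [set: U]).
Hypothesis lawP : is_path_law k mu P.

Definition support : set U := [set t | exists n, 0 < P [set w | w n = t]].

Lemma step_closed_support : step_closed k support.
Proof.
move=> x y [n xn] xy; exists n.+1; rewrite lt0e measure_ge0 andbT; apply/eqP.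
move=> /(path_law_step_null lawP n (mU [set y])) y0.
move: xn; rewrite ltNge -y0 => /negP; apply.
apply: le_measure; rewrite ?inE.
- exact: (measurable_eval_preimage n (mU [set x])).
- exact: (measurable_eval_preimage n (mU [set s | k s [set y] <> 0])).
- by move=> w /= -> e; rewrite e ltxx in xy.
Qed.

Lemma path_law_hit_support (A B : set U) (nu : probability U R)
    (P' : probability (path_space U) R) :
  finite_set A -> (forall t, support t -> escape k A t = 0) ->
  (forall t, support t -> exists2 u, reach k t u & B u) ->
  is_path_law k nu P' -> (forall t, 0 < nu [set t] -> support t) ->
  P' (eventually_in B) = 1.
Proof.
move=> fA A0 hB lawP' nusupp; apply/(path_law_hit_escape mU cU _ lawP') => t /nusupp.
exact: (escape_eq0 mU cU step_closed_support fA).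
Qed.

End support.

(** * Transfer of null events along an abstraction *)

Section abstraction_laws.
Context (R : realType) (d d' : measure_display).
Context (V : measurableType d) (U : measurableType d').
Variables (k1 : R.-pker V ~> V) (k2 : R.-pker U ~> U) (b : {mfun V >-> U}).
Hypothesis mU : forall A : set U, measurable A.
Hypothesis kb : forall s B, k1 s (b @^-1` B) = 0 <-> k2 (b s) B = 0.
Variables (mu : probability V R) (P1 : probability (path_space V) R).
Variable P2 : probability (path_space U) R.
Hypotheses (lawP1 : is_path_law k1 mu P1).
Hypotheses (lawP2 : is_path_law k2 (distribution mu b) P2).

Let mb (B : set U) : measurable (b @^-1` B).
Proof. by rewrite -[X in measurable X]setTI; exact: measurable_funPT. Qed.

(** Induction on time: nullity at time [n.+1] is nullity at time [n] of the states with a positive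
    chance to enter [B], and by [kb] these sets of states correspond under [b]. *)
Lemma abstraction_null_laws n (B : set U) :
  P1 [set w | B (b (w n))] = 0 <-> P2 [set w | B (w n)] = 0.
Proof.
elim: n B => [|n IH] B.
  rewrite (path_law_init lawP2 (mU B)).
  by rewrite (path_law_init (B := b @^-1` B) lawP1 (mb B)).
rewrite (path_law_step_null lawP2 n (mU B)).
rewrite (path_law_step_null (B := b @^-1` B) lawP1 n (mb B)).
rewrite -(IH [set t | k2 t B <> 0]).
rewrite (_ : [set w | _] = [set w : path_space V | k2 (b (w n)) B <> 0])//.
by apply/seteqP; split=> w /= h /kb.
Qed.

Lemma abstraction_pos n t :
  0 < P1 [set w | b (w n) = t] <-> 0 < P2 [set w | w n = t].
Proof.
by rewrite !lt0e !measure_ge0 !andbT; split=> /eqP h; apply/eqP;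
  move=> /(abstraction_null_laws n [set t]).
Qed.

Lemma abstraction_stay n (C : set U) : countable [set: U] -> step_closed k2 C ->
  P1 [set w | C (b (w n)) /\ ~ C (b (w n.+1))] = 0.
Proof.
move=> cU cC; apply: (path_law_stay (C := b @^-1` C) lawP1 n (mb C)) => s Cs.
by rewrite preimage_setC; apply/kb; exact: step_closed_null.
Qed.

End abstraction_laws.

(** * Equivalence of almost sure acceptance in the two products *)

Theorem corollary55 (R : realType) (d1 d2 : measure_display)
    (S1 : measurableType d1) (S2 : measurableType d2) (AP : finType)
    (T1 : lsts R S1 AP) (T2 : lsts R S2 AP)
    (alpha : {mfun S1 >-> S2}) (M : muller AP)
    (T2_denumerable : denumerable T2)
    (T2_attractor : exists2 A : set S2, finite_set A & attractor T2 A)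
    (T2_abstraction : abstraction T1 T2 alpha)
    (product_sound :
      sound_abstraction (product T1 M) (product T2 M) (product_map alpha M))
    (mu : probability S1 R)
    (P1 : probability (path_space (S1 * mspace M)%type) R)
    (P2 : probability (path_space (S2 * mspace M)%type) R)
    (P1_law : is_path_law (product T1 M) (mu \x \d_(minit M : mspace M)) P1)
    (P2_law : is_path_law (product T2 M)
      (distribution (mu \x \d_(minit M : mspace M)) (product_map alpha M)) P2) :
  P1 (inf_accept M) = 1 <-> P2 (inf_accept M) = 1.
Proof.
have [cS2 mS2] := T2_denumerable.
have [A0 fA0 [mA0 attrA0]] := T2_attractor.
have [[stoch _ _] sound] := product_sound.
pose U : measurableType _ := (S2 * mspace M)%type.
pose V : measurableType _ := (S1 * mspace M)%type.
set b := product_map alpha M in stoch sound P2_law.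
set k1 := product T1 M in stoch sound P1_law.
set k2 := product T2 M in stoch sound P2_law.
have cU : countable [set: U].
  rewrite -setXTT; apply: countableX => //; exact/finite_set_countable/finite_finset.
have mU (B : set U) : measurable B.
  apply: countable_measurable => [[s q]|].
    rewrite (_ : [set _] = [set s] `*` [set q]); first exact: measurableX.
    by apply/seteqP; split=> [_ ->|[? ?] [/= -> ->]].
  exact: sub_countable (subset_card_le (@subsetT _ B)) cU.
have kb s B : k1 s (b @^-1` B) = 0 <-> k2 (b s) B = 0.
  have mk1 : measurable_fun setT (fun x => k1 x (b @^-1` B)).
    apply: measurable_kernel; rewrite -[X in measurable X]setTI.
    exact: measurable_funPT.
  have mk2 : measurable_fun setT (fun x => k2 x B) by exact: measurable_kernel.
  (* Dirac initial laws turn the abstraction property into a pointwise one. *)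
  have := stoch \d_s B (mU B).
  rewrite /pushforward /Omega integral_dirac// diracT mul1e.
  rewrite ge0_integral_distribution// integral_dirac ?diracT ?mul1e//.
  exact: measurableT_comp.
set Re := support P2.
pose A : set U := [set x | A0 x.1].
have fA : finite_set A.
  apply: (sub_finite_set (B := A0 `*` [set: mspace M])); first by move=> x.
  by apply: finite_setX => //; exact: finite_finset.
have ReA t : Re t -> escape k2 A t = 0.
  move=> [n tn].
  (* The shifted law charges [t] initially. Its projection to [S2] is a path law of [T2], which
     almost surely hits [A0]; hence the shifted law almost surely hits [A]. *)
  have lawn := path_law_shift n P2_law.
  apply: (path_law_hit_escape mU cU A lawn).1 => //.
  have kf s B : measurable B -> k2 s ((fst : U -> S2) @^-1` B) = T2 s.1 B.
    move=> mB; have [q e] := product_kernel_next T2 s.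
    by rewrite /k2 [LHS](congr1 (@^~ _) e).
  exact: attrA0 (path_law_lumping (f := fst) kf lawn).
have hrec t : Re t -> exists2 a, reach k2 t a & recurrent k2 A Re a.
  apply: (recurrent_reachable mU cU fA) => //; exact: step_closed_support mU P2_law.
have main1 : P1 (inf_accept M) = 1 <-> forall a, recurrent k2 A Re a ->
    class_colours k2 (fun u : U => u.2 : mstates M) a \in maccept M.
  (* Since [b] keeps the automaton state, [inf_accept M] unfolds to the event on the colours of
     [b \o w]. *)
  apply: (@inf_colours_recurrent _ _ _ k2 A Re mU cU _ _ _ _ P1 b) => //.
  - by move=> a [_ [n /(abstraction_pos mU kb P1_law P2_law)]]; exists n.
  - move=> n B hB.
    rewrite -(path_law_visit P1 n (b @^-1` B)).
    have pos := abstraction_pos mU kb P1_law P2_law n.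
    have law1 := path_law_shift n P1_law.
    have law2 := path_law_shift n P2_law.
    (* Soundness at time [n] needs a path law started from the image under [b] of the time-[n] law
       of [P1]. This image charges the same states as [P2] at time [n], so such a law arises from
       the shifted [P2]. *)
    have [|P' lawP'] := path_law_abs_cont mU cU
      (nu := distribution (distribution P1 (path_eval n)) b) law2.
      by move=> t /pos.
    apply: (sound _ _ (mU B) _ _ law1 lawP').
    apply: (path_law_hit_support mU cU P2_law fA ReA hB lawP') => t /pos tn.
    by exists n.
  - by move=> n C cC; exact: (abstraction_stay mU kb P1_law).
have main2 : P2 (inf_accept M) = 1 <-> forall a, recurrent k2 A Re a ->
    class_colours k2 (fun u : U => u.2 : mstates M) a \in maccept M.
  apply: (@inf_colours_recurrent _ _ _ k2 A Re mU cU _ _ _ _ P2 idfun) => //.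
  - by move=> a [_ [n an]]; exists n.
  - move=> n B hB; rewrite -(path_law_visit P2 n B).
    have lawn := path_law_shift n P2_law.
    apply: (path_law_hit_support mU cU P2_law fA ReA hB lawn) => t tn.
    by exists n.
  - move=> n C cC; apply: (path_law_stay P2_law n (mU C)) => s Cs.
    exact: step_closed_null.
by rewrite main1 main2.
Qed.
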